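(* Let $H$ be a target graph, possibly with loops, and let $k$ be the number of automorphic similarity classes of $H$. There are real numbers $\lambda_1,\ldots,\lambda_k$, dependent only on $H$, such that the following holds. Let $G_0$ be a graph, fix a vertex $v_0\in V(G_0)$, and let $\{G_n\}_{n=0}^\infty$ be the path-like family with seed graph $G_0$ and fixed vertex $v_0$. Then there are real numbers $c_1,\ldots,c_k$, dependent on $G_0$, $v_0$, and $H$ (but not on $n$), such that for all $n\ge 0$, $$\hom(G_n,H)=\sum_{i=1}^k c_i\lambda_i^n .$$
   Context: All graphs are finite. For a simple loopless graph $G$ and a target graph $H$ (possibly with loops, no multi-edges), an $H$-coloring of $G$ is a map $f:V(G)\to V(H)$ such that $f(x)$ and $f(y)$ are adjacent in $H$ whenever $x$ and $y$ are adjacent in $G$ (a looped vertex is adjacent to itself); $\hom(G,H)$ denotes the number of $H$-colorings of $G$. Vertices $u,v$ of $H$ are automorphically similar if some automorphism of $H$ sends $u$ to $v$. This is an equivalence relation on $V(H)$; its equivalence classes are the automorphic similarity classes of $H$. Path-like family: given a graph $G_0$ (simple, loopless, not necessarily a tree) and a vertex $v_0$ of $G_0$, for $n\ge 0$ the graph $G_n$ is formed from $G_0$ by appending a path with $n$ new vertices to $v_0$, i.e. adding new vertices $v_1,\dots,v_n$ and the edges $v_{i-1}v_i$ for $1\le i\le n$. $\{G_n\}_{n=0}^\infty$ is the path-like family with seed graph $G_0$ and fixed vertex $v_0$. Convention: $0^0=1$. *)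

(* Defs.v *)
From HB Require Import structures.
From mathcomp Require Import all_boot all_order all_algebra all_fingroup.
From mathcomp Require Import reals.

Set Implicit Arguments.
Unset Strict Implicit.
Unset Printing Implicit Defensive.

(* Target graphs: finite, undirected, no multi-edges; a loop at x is the fact
   adj x x. *)
Record lgraph := LGraph {
  lvert :> finType;
  adj : rel lvert;
  adj_sym : symmetric adj }.

Record sgraph := SGraph {
  sgraph_lgraph :> lgraph;
  adj_irr : irreflexive (@adj sgraph_lgraph) }.

Definition is_coloring (G : sgraph) (H : lgraph) (f : {ffun G -> H}) : bool :=
  [forall x, forall y, adj x y ==> adj (f x) (f y)].

Definition num_colorings (G : sgraph) (H : lgraph) : nat :=
  #|[set f : {ffun G -> H} | is_coloring f]|.

Definition is_automorphism (H : lgraph) (s : {perm H}) : bool :=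
  [forall x, forall y, adj (s x) (s y) == adj x y].

Definition aut_similar (H : lgraph) : rel H :=
  fun u v => [exists s : {perm H}, is_automorphism s && (s u == v)].

Lemma aut_similar_equiv (H : lgraph) :
  {in [set: H] & &, equivalence_rel (@aut_similar H)}.
Proof.
have sim_sym (u v : H) : aut_similar u v -> aut_similar v u.
  case/existsP=> s /andP[/forallP sA /eqP <-].
  apply/existsP; exists (s^-1)%g; rewrite permK eqxx andbT.
  apply/forallP=> x; apply/forallP=> y.
  have /forallP/(_ ((s^-1)%g y)) := sA ((s^-1)%g x).
  by rewrite !permKV eq_sym.
have sim_trans (u v w : H) :
    aut_similar u v -> aut_similar v w -> aut_similar u w.
  case/existsP=> s /andP[/forallP sA /eqP <-].
  case/existsP=> t /andP[/forallP tA /eqP <-].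
  apply/existsP; exists (s * t)%g; rewrite permM eqxx andbT.
  apply/forallP=> x; apply/forallP=> y; rewrite !permM.
  have /forallP/(_ (s y))/eqP-> := tA (s x).
  by have /forallP/(_ y) := sA x.
move=> x y z _ _ _; split=> [|xy].
  apply/existsP; exists 1%g; rewrite perm1 eqxx andbT.
  by apply/forallP=> a; apply/forallP=> b; rewrite !perm1.
by apply/idP/idP; apply: sim_trans => //; apply: sim_sym.
Qed.

Definition similarity_classes (H : lgraph) : {set {set H}} :=
  equivalence_partition (@aut_similar H) [set: H].

Section PathLike.

Variables (G0 : sgraph) (v0 : G0) (n : nat).

(* inl x is the vertex x of the seed graph; inr i, with 0 <= i < n, is the new
   vertex v_(i+1). *)
Definition path_like_adj : rel (G0 + 'I_n)%type := fun a b =>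
  match a, b with
  | inl x, inl y => adj x y
  | inl x, inr j => (x == v0) && (val j == 0)
  | inr i, inl y => (y == v0) && (val i == 0)
  | inr i, inr j => (val j == i.+1) || (val i == j.+1)
  end.

Lemma path_like_sym : symmetric path_like_adj.
Proof. by move=> [x|i] [y|j] //=; [apply: adj_sym | rewrite orbC]. Qed.

Lemma path_like_irr : irreflexive path_like_adj.
Proof.
by move=> [x|i] /=; [apply: adj_irr | rewrite orbb ltn_eqF].
Qed.

Definition path_like : sgraph :=
  @SGraph (LGraph path_like_sym) path_like_irr.

End PathLike.

(* Main.v *)
(** A coloring of [G_n] is a coloring of [G_0] together with an [n]-step walk in
    [H] from the color of [v_0], so it suffices to treat the numbers [w_n u] of
    [n]-step walks from [u]. The number of neighbours of [u] in a similarity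
    class depends only on the class of [u]; hence, writing [C_1, ..., C_k] for
    the classes and [e_ij] for the number of adjacent pairs in [C_i * C_j], the
    vector [sqrt |C_i| w_n(C_i)] is obtained by applying [n] times the symmetric
    [k * k] matrix [e_ij / sqrt (|C_i| |C_j|)], which the spectral theorem
    diagonalizes with real eigenvalues. *)
Require Import Defs.
From HB Require Import structures.
From mathcomp Require Import all_boot all_order all_algebra all_fingroup.
From mathcomp Require Import reals complex ring.

Import Order.TTheory GRing.Theory Num.Theory.
Local Open Scope ring_scope.

Fixpoint num_walks (H : lgraph) (n : nat) (u : H) : nat :=
  if n is n'.+1 then (\sum_(v | adj u v) num_walks H n' v)%N else 1%N.

Lemma sum_tupleS (T : finType) (n : nat) (F : n.+1.-tuple T -> nat) :
  (\sum_t F t = \sum_x \sum_(t : n.-tuple T) F [tuple of x :: t])%N.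
Proof.
rewrite pair_big /= (reindex (fun p : T * n.-tuple T => [tuple of p.1 :: p.2])) //=.
exists (fun t : n.+1.-tuple T => (thead t, [tuple of behead t])) => [[x t]|t] _.
  by rewrite theadE; congr pair; apply: val_inj.
by rewrite -tuple_eta.
Qed.

(** The tuple lists the vertices that follow [u] on a walk; splitting off its head gives the
    recursion of [num_walks]. *)
Lemma num_walksE (H : lgraph) (n : nat) (u : H) :
  (\sum_(t : n.-tuple H) path (@adj H) u t = num_walks H n u)%N.
Proof.
elim: n u => [|n IHn] u /=.
  rewrite (big_pred1 [tuple]) // => t; apply/esym/eqP.
  exact: tuple0.
rewrite sum_tupleS [RHS]big_mkcond /=; apply: eq_bigr => v _ /=.
by case: (adj u v) => /=; [exact: IHn | rewrite big1].
Qed.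

Definition glue_coloring {G0 : sgraph} {H : lgraph} {n : nat}
    (p : {ffun G0 -> H} * n.-tuple H) : {ffun G0 + 'I_n -> H} :=
  [ffun a : G0 + 'I_n => match a with inl x => p.1 x | inr i => tnth p.2 i end].

Lemma glue_coloring_bij (G0 : sgraph) (H : lgraph) (n : nat) :
  bijective (@glue_coloring G0 H n).
Proof.
exists (fun F : {ffun G0 + 'I_n -> H} =>
    ([ffun x => F (inl x)], [tuple F (inr i) | i < n])) => [[f t]|F].
  congr pair; first by apply/ffunP=> x; rewrite !ffunE.
  by apply: eq_from_tnth => i; rewrite tnth_mktuple ffunE.
by apply/ffunP=> -[x|i]; rewrite !ffunE ?tnth_mktuple.
Qed.

Lemma glue_coloringP (G0 : sgraph) (v0 : G0) (H : lgraph) (n : nat)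
    (f : {ffun G0 -> H}) (t : n.-tuple H) :
  is_coloring (glue_coloring (f, t) : {ffun path_like v0 n -> H}) =
  is_coloring f && path (@adj H) (f v0) t.
Proof.
apply/idP/andP => [/'forall_forallP gl | [/'forall_forallP fc /pathP tp]].
  split.
    apply/'forall_forallP => x y.
    by have := gl (inl x) (inl y); rewrite !ffunE.
  (* Entry [i] of [f v0 :: t] must be adjacent to entry [i] of [t]: index 0 is the edge from [v0] to
     the first new vertex, and later indices are edges between consecutive new vertices. *)
  apply/(pathP (f v0)) => i; rewrite size_tuple => lt_in.
  have tE (j : 'I_n) : nth (f v0) t j = tnth t j by rewrite (tnth_nth (f v0)).
  case: i lt_in => [|i] lt_in /=.
    have := gl (inl v0) (inr (Ordinal lt_in)).
    by rewrite !ffunE /= eqxx -tE.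
  have := gl (inr (Ordinal (ltnW lt_in))) (inr (Ordinal lt_in)).
  by rewrite !ffunE /= eqxx -!tE.
have edge0 (j : 'I_n) : val j == 0%N -> adj (f v0) (tnth t j).
  move=> /eqP j0; have := tp (f v0) 0%N; rewrite size_tuple -{1}j0 ltn_ord.
  by rewrite (tnth_nth (f v0)) j0; apply.
have edgeS (i j : 'I_n) : val j == i.+1 -> adj (tnth t i) (tnth t j).
  move=> /eqP jS; have := tp (f v0) i.+1; rewrite size_tuple -{1}jS ltn_ord.
  by rewrite !(tnth_nth (f v0)) jS /=; apply.
apply/'forall_forallP => -[x|i] [y|j]; rewrite !ffunE /=; apply/implyP.
- by apply/implyP/fc.
- by case/andP=> /eqP-> /edge0.
- by case/andP=> /eqP-> /edge0; rewrite adj_sym.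
- by case/orP=> /edgeS //; rewrite adj_sym.
Qed.

Lemma num_colorings_path_like (G0 : sgraph) (v0 : G0) (H : lgraph) (n : nat) :
  num_colorings (path_like v0 n) H =
  (\sum_(f : {ffun G0 -> H} | is_coloring f) num_walks H n (f v0))%N.
Proof.
rewrite /num_colorings -sum1dep_card big_mkcond.
rewrite (reindex (@glue_coloring G0 H n)); last first.
  exact/onW_bij/glue_coloring_bij.
transitivity (\sum_(f : {ffun G0 -> H}) \sum_(t : n.-tuple H)
    (is_coloring f && path (@adj H) (f v0) t))%N.
  rewrite pair_bigA; apply: eq_bigr => -[f t] _.
  by rewrite glue_coloringP; case: (_ && _).
rewrite [RHS]big_mkcond; apply: eq_bigr => f _.
case: (is_coloring f) => /=; last by rewrite big1.
exact: num_walksE.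
Qed.

(** In the coordinates [P *m x], applying [A] multiplies the [j]-th coordinate by [d 0 j], so only
    the powers depend on [n]. *)
Lemma diag_iter (C : fieldType) (k : nat) (A P : 'M[C]_k) (d : 'rV[C]_k)
    (x : 'cV[C]_k) (n : nat) (i : 'I_k) :
  P \in unitmx -> A = invmx P *m diag_mx d *m P ->
  iter n (mulmx A) x i 0 =
  \sum_j (invmx P i j * (P *m x) j 0) * d 0 j ^+ n.
Proof.
move=> Pu AE.
have -> : iter n (mulmx A) x =
    invmx P *m (\col_j (d 0 j ^+ n * (P *m x) j 0)).
  elim: n => [|n IHn] /=.
    rewrite -[LHS](mulKmx Pu); congr mulmx.
    by apply/colP=> j; rewrite [RHS]mxE mul1r.
  rewrite IHn {1}AE -!mulmxA (mulKVmx Pu); congr mulmx.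
  apply/colP=> j; rewrite mul_diag_mx !mxE exprS; ring.
by rewrite mxE; apply: eq_bigr => j _; rewrite [in LHS]mxE mulrAC mulrA.
Qed.

(** Over [R[i]] the matrix is Hermitian, hence unitarily diagonalizable with real eigenvalues. The
    coefficients may be complex, but the left side is real, so their real parts suffice. *)
Lemma symmetric_iter (R : rcfType) (k : nat) (S : 'M[R]_k) : S^T = S ->
  exists lambda : 'I_k -> R, forall x : 'cV[R]_k, exists c : 'I_k -> 'I_k -> R,
  forall n i, iter n (mulmx S) x i 0 = \sum_j c i j * lambda j ^+ n.
Proof.
move=> Ssym; pose A := map_mx (real_complex R) S.
have Aherm : A \is hermsymmx.
  apply: realsym_hermsym.
    by apply/is_hermitianmxP; rewrite expr0 scale1r map_mx_id // map_trmx Ssym.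
  by apply/mxOverP => i j; rewrite mxE complex_real.
have AE := orthomx_spectralP (hermitian_normalmx Aherm).
set d := spectral_diag A in AE; set P := spectralmx A in AE.
have dE j : d 0 j = (complex.Re (d 0 j))%:C%C.
  by rewrite RRe_real //; apply/mxOverP/hermitian_spectral_diag_real.
exists (fun j => complex.Re (d 0 j)) => x.
pose y := map_mx (real_complex R) x.
exists (fun i j => complex.Re (invmx P i j * (P *m y) j 0)) => n i.
have iterC : map_mx (real_complex R) (iter n (mulmx S) x) = iter n (mulmx A) y.
  by elim: n => //= n IHn; rewrite map_mxM IHn.
have -> : iter n (mulmx S) x i 0 = complex.Re (iter n (mulmx A) y i 0).
  by rewrite -iterC mxE.
rewrite (diag_iter _ _ _ _ _ _ _ _ (spectral_unit A) AE).
rewrite (raddf_sum (@complex.Re R : {additive _ -> _})).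
(* The power of the eigenvalue is real, so it factors out of the real part. *)
apply: eq_bigr => j _; rewrite {1}dE -rmorphXn.
by case: (invmx P i j * _) => a b /=; rewrite mulr0 subr0.
Qed.

Lemma aut_similar_transl (H : lgraph) (u v w : H) :
  aut_similar u v -> aut_similar u w = aut_similar v w.
Proof.
have [_ E] :=
  @aut_similar_equiv H u v w (in_setT _) (in_setT _) (in_setT _).
exact: E.
Qed.

Lemma aut_similar_refl (H : lgraph) : reflexive (@aut_similar H).
Proof.
move=> u.
by case: (@aut_similar_equiv H u u u (in_setT _) (in_setT _) (in_setT _)).
Qed.

Lemma mem_class (H : lgraph) (C : {set H}) (u v : H) :
  C \in similarity_classes H -> u \in C -> (v \in C) = aut_similar u v.
Proof.
case/imsetP=> x _ ->; rewrite !inE /= => xu.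
exact: aut_similar_transl.
Qed.

Lemma classes_partition (H : lgraph) :
  partition (similarity_classes H) [set: H].
Proof. exact/equivalence_partitionP/aut_similar_equiv. Qed.

Definition class_degree (H : lgraph) (C : {set H}) (u : H) : nat :=
  (\sum_(v in C) adj u v)%N.

(** An automorphism taking [u] to [v] preserves the class [D], so it maps the neighbours of [u] in
    [D] bijectively onto those of [v]. *)
Lemma class_degree_similar (H : lgraph) (C D : {set H}) (u v : H) :
  C \in similarity_classes H -> D \in similarity_classes H ->
  u \in C -> v \in C -> class_degree H D u = class_degree H D v.
Proof.
move=> CH DH uC; rewrite (mem_class H C u) // => /existsP[s /andP[sA /eqP <-]].
rewrite /class_degree [RHS](reindex_inj (@perm_inj _ s)) /=.
apply: eq_big => [w|w _]; last by rewrite (eqP (forallP (forallP sA u) w)).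
have ws : aut_similar w (s w) by apply/existsP; exists s; rewrite sA eqxx.
have [wD|wND] := boolP (w \in D); first by rewrite (mem_class H D w).
apply/esym/negP => swD; case/negP: wND; rewrite (mem_class H D (s w)) //.
by rewrite -(aut_similar_transl H w) // aut_similar_refl.
Qed.

Lemma num_walks_geometric (R : rcfType) (H : lgraph) :
  exists (lambda : 'I_#|similarity_classes H| -> R)
         (c : H -> 'I_#|similarity_classes H| -> R),
  forall n u, (num_walks H n u)%:R = \sum_j c u j * lambda j ^+ n.
Proof.
set k := #|similarity_classes H|.
pose C (i : 'I_k) : {set H} := enum_val i.
have CH i : C i \in similarity_classes H := enum_valP i.
have [cls clsP] : exists cls : H -> 'I_k, forall u, u \in C (cls u).
  apply: (@fin_all_exists H _ (fun u i => u \in C i)) => u.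
  have /bigcupP[D DH uD] : u \in cover (similarity_classes H).
    by rewrite (cover_partition (classes_partition H)).
  by exists (enum_rank_in DH D); rewrite /C enum_rankK_in.
have cls_uniq v j : v \in C j -> cls v = j.
  move=> vC; apply: enum_val_inj; rewrite -/(C _) -/(C j).
  have [_ tI _] := and3P (classes_partition H).
  by rewrite -(def_pblock tI (CH j) vC) (def_pblock tI (CH _) (clsP v)).
(* The matrix of class degrees need not be symmetric; conjugating it by the diagonal matrix of the
   [r i] makes it so. *)
pose r i : R := Num.sqrt #|C i|%:R.
have r2 i : r i * r i = #|C i|%:R by rewrite -expr2 sqr_sqrtr ?ler0n.
have r_neq0 i : r i != 0.
  have [_ _ C0] := and3P (classes_partition H).
  rewrite sqrtr_eq0 -ltNge ltr0n card_gt0.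
  by apply: contraNneq C0 => <-.
pose e i j : R := (\sum_(u in C i) class_degree H (C j) u)%:R.
have e_sym i j : e i j = e j i.
  congr _%:R; rewrite /class_degree exchange_big /=.
  by apply: eq_bigr => v _; apply: eq_bigr => u _; rewrite adj_sym.
(* All [#|C i|] vertices of [C i] have the same degree into [C j]. *)
have eE i j u : u \in C i -> e i j = (class_degree H (C j) u)%:R * (r i * r i).
  move=> uC; rewrite r2 -natrM /e mulnC; congr _%:R.
  rewrite -sum_nat_const; apply: eq_bigr => v vC.
  exact: (class_degree_similar H (C i)).
pose S : 'M[R]_k := \matrix_(i, j) (e i j / (r i * r j)).
have Ssym : S^T = S.
  by apply/matrixP=> i j; rewrite !mxE e_sym [r j * _]mulrC.
have [lambda lambdaP] := symmetric_iter R k S Ssym.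
(* There is one walk of length 0 from each vertex, so the scaled starting vector is [r] itself. *)
have [c cP] := lambdaP (\col_i r i).
exists lambda, (fun u j => c (cls u) j / r (cls u)) => n u.
transitivity (iter n (mulmx S) (\col_i r i) (cls u) 0 / r (cls u)); last first.
  by rewrite cP mulr_suml; apply: eq_bigr => j _; rewrite mulrAC.
elim: n u => [|n IHn] u /=; first by rewrite mxE divff ?r_neq0.
rewrite natr_sum mxE mulr_suml.
(* The neighbours of [u] are grouped by class; by induction the walk count is constant on each
   class. *)
transitivity (\sum_j (class_degree H (C j) u)%:R *
                (iter n (mulmx S) (\col_i r i) j 0 / r j)).
  rewrite big_mkcond (eq_bigl [in [set: H]]) => [|v]; last by rewrite !inE.
  rewrite (set_partition_big _ (classes_partition H)) /= big_enum_val.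
  apply: eq_bigr => j _; rewrite natr_sum mulr_suml; apply: eq_bigr => v vC.
  rewrite IHn (cls_uniq v j) //.
  by case: ifP => _; rewrite ?mul1r ?mul0r.
apply: eq_bigr => j _; rewrite mxE (eE _ _ u) //.
by field; rewrite !r_neq0.
Qed.

Theorem corollary2p4 (R : realType) (H : lgraph) :
  exists lambda : 'I_#|similarity_classes H| -> R,
  forall (G0 : sgraph) (v0 : G0),
  exists c : 'I_#|similarity_classes H| -> R,
  forall n : nat,
    (num_colorings (path_like v0 n) H)%:R =
      \sum_(i < #|similarity_classes H|) c i * lambda i ^+ n.
Proof.
have [lambda [c cP]] := num_walks_geometric R H.
exists lambda => G0 v0.
(* The seed graph enters only through the colors that its colorings give to [v0], hence only through
   the coefficients. *)
exists (fun j => \sum_(f : {ffun G0 -> H} | is_coloring f) c (f v0) j) => n.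
rewrite num_colorings_path_like natr_sum.
under eq_bigr do rewrite cP.
by rewrite exchange_big; apply: eq_bigr => j _; rewrite mulr_suml.
Qed.
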